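(* Let $X$ be a 0-representable merge-bicategory. Then: (a) a 1-cell $1_x: x \to x$ is a tensor unit if and only if it is a par unit; (b) a 1-cell $e: x \to y$ is tensor universal if and only if it is par universal. Moreover, the 2-cells that exhibit $1_x$ as a par unit, or $e$ as par universal, can be chosen as inverses of the 2-cells that exhibit $1_x$ as a tensor unit, or $e$ as tensor universal.
   Context: A regular 2-polygraph $X$ consists of a set of 0-cells, a set of 1-cells $a: x \to y$ (each with a source and a target 0-cell), and, for all $n,m\ge 1$, a set of 2-cells $p:(a_1,\ldots,a_n)\to(b_1,\ldots,b_m)$, whose input and output are non-empty composable sequences of 1-cells with the same initial source and the same final target. Greek capitals denote possibly empty composable sequences of 1-cells, and commas denote concatenation. A merge-bicategory is a regular 2-polygraph with operations: given $t:(\Gamma)\to(\Delta_1,\Lambda,\Delta_2)$ and $s:(\Gamma_1,\Lambda,\Gamma_2)\to(\Delta)$ with $\Lambda$ non-empty, occupying outputs $j_1,\ldots,j_2$ of $t$ and inputs $i_1,\ldots,i_2$ of $s$, such that ($\Gamma_1$ or $\Delta_1$ is empty) and ($\Gamma_2$ or $\Delta_2$ is empty), a 2-cell $\mathrm{mrg}_{[j_1,j_2]}^{[i_1,i_2]}(t,s):(\Gamma_1,\Gamma,\Gamma_2)\to(\Delta_1,\Delta,\Delta_2)$. These satisfy associativity and interchange equations: whenever the same pasting diagram of three 2-cells (with the same identifications of output 1-cells with input 1-cells) can be evaluated by two successive merges in two different orders, the two results are equal. No units are part of the structure. A unit on a non-empty composable sequence $\Gamma$ is a 2-cell $\mathrm{id}_\Gamma:(\Gamma)\to(\Gamma)$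 such that merging any 2-cell with $\mathrm{id}_\Gamma$ along the whole of $\Gamma$, on either side, returns that 2-cell. $X$ is unital if every non-empty composable sequence has a unit. An inverse of $p:(\Gamma)\to(\Delta)$ is $p^{-1}:(\Delta)\to(\Gamma)$ whose merges with $p$ along $\Delta$ and along $\Gamma$ are $\mathrm{id}_\Gamma$ and $\mathrm{id}_\Delta$. A 2-cell $t:(\Gamma)\to(\Delta_1,a,\Delta_2)$, with $a$ its $j$-th output, is universal at $\partial_j^+$ if for all $\Gamma_1,\Gamma_2$ and non-empty $\Delta$ with ($\Gamma_1$ or $\Delta_1$ empty) and ($\Gamma_2$ or $\Delta_2$ empty), every $s:(\Gamma_1,\Gamma,\Gamma_2)\to(\Delta_1,\Delta,\Delta_2)$ is the merge along $a$ of $t$ and a unique $r:(\Gamma_1,a,\Gamma_2)\to(\Delta)$. Dually, $t:(\Gamma_1,a,\Gamma_2)\to(\Delta)$, with $a$ its $i$-th input, is universal at $\partial_i^-$ if for all $\Delta_1,\Delta_2$ and non-empty $\Gamma$ with the same conditions, every $s:(\Gamma_1,\Gamma,\Gamma_2)\to(\Delta_1,\Delta,\Delta_2)$ is the merge along $a$ of a unique $r:(\Gamma)\to(\Delta_1,a,\Delta_2)$ and $t$. A 1-cell $1_x: x\to x$ is a tensor unit if for each $a: x\to y$ there is a 2-cell $(1_x,a)\to(a)$ universal at $\partial_1^+$ and $\partial_2^-$, and for each $b:z\to x$ a 2-cell $(b,1_x)\to(b)$ universal at $\partial_1^+$ and $\partial_1^-$. It is a par unit if for each $a: x\to y$ there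 is a 2-cell $(a)\to(1_x,a)$ universal at $\partial_1^-$ and $\partial_2^+$, and for each $b:z\to x$ a 2-cell $(b)\to(b,1_x)$ universal at $\partial_1^-$ and $\partial_1^+$. A 1-cell $e: x \to x'$ is tensor universal if: for each $a:x\to y$ there is a 2-cell $(e,u)\to(a)$, and for each $a':x'\to y$ a 2-cell $(e,a')\to(v)$, both universal at $\partial_1^+$ and $\partial_2^-$; and for each $b':z\to x'$ there is a 2-cell $(u',e)\to(b')$, and for each $b:z\to x$ a 2-cell $(b,e)\to(v')$, both universal at $\partial_1^+$ and $\partial_1^-$ (for some 1-cells $u,v,u',v'$). It is par universal if: for each $a:x\to y$ there is a 2-cell $(a)\to(e,u)$, and for each $a':x'\to y$ a 2-cell $(v)\to(e,a')$, both universal at $\partial_1^-$ and $\partial_2^+$; and for each $b':z\to x'$ there is a 2-cell $(b')\to(u',e)$, and for each $b:z\to x$ a 2-cell $(v')\to(b,e)$, both universal at $\partial_1^-$ and $\partial_1^+$ (for some $u,v,u',v'$). The 2-cells listed in these definitions are those said to exhibit the corresponding property. $X$ is 0-representable if it is unital and every 0-cell has both a tensor unit and a par unit. *)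

(* Defs.v *)
From mathcomp Require Import all_boot.

Set Implicit Arguments.
Unset Strict Implicit.
Unset Printing Implicit Defensive.

(* [is_path src tgt x s y]: the sequence s of 1-cells is composable, from x
   to y; the empty sequence is a path from x to x. *)
Fixpoint is_path (C0 C1 : Type) (src tgt : C1 -> C0)
    (x : C0) (s : seq C1) (y : C0) : Prop :=
  if s is a :: s' then src a = x /\ is_path src tgt (tgt a) s' y else x = y.

(* All 2-cells live in one type, with their boundary given by functions, so
   that equations between merges need no transport along equalities of
   boundaries; "p : (G) -> (D)" is [hom2 p G D] below. *)
Record polygraph2 := Polygraph2 {
  cell0 : Type;
  cell1 : Type;
  cell2 : Type;
  src : cell1 -> cell0;
  tgt : cell1 -> cell0;
  inp : cell2 -> seq cell1;
  outp : cell2 -> seq cell1;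
  inp_neq0 : forall p, inp p <> [::];
  outp_neq0 : forall p, outp p <> [::];
  boundary_path : forall p, exists x y,
    is_path src tgt x (inp p) y /\ is_path src tgt x (outp p) y
}.

Definition hom1 (X : polygraph2) (a : cell1 X) (x y : cell0 X) : Prop :=
  src a = x /\ tgt a = y.

Definition hom2 (X : polygraph2) (p : cell2 X) (G D : seq (cell1 X)) : Prop :=
  inp p = G /\ outp p = D.

(* t : (G) -> (D1, L, D2) and s : (G1, L, G2) -> (D) can be merged along L. *)
Definition mergeable (X : polygraph2) (t s : cell2 X)
    (D1 L D2 G1 G2 : seq (cell1 X)) : Prop :=
  [/\ outp t = D1 ++ L ++ D2,
      inp s = G1 ++ L ++ G2,
      L <> [::],
      G1 = [::] \/ D1 = [::]
    & G2 = [::] \/ D2 = [::]].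

(* [mrg j i l t s] identifies the l outputs of t starting at position j with
   the l inputs of s starting at position i.  Positions count from 0, so it is
   mrg_[j+1,j+l]^[i+1,i+l](t,s).  Merging is a partial operation, represented
   by a total function: nothing is assumed about its values when the
   identification is not an instance of [mergeable].

   The three laws equate the two ways of evaluating a diagram of three 2-cells.
   Merging first two of them and then the third leaves, up to exchanging the
   two evaluations, three shapes of diagram:
   - t feeds s and s feeds r ([mrg_assoc]), where t may also feed r directly,
     on the left of s along L1 or on its right along L2 (each possibly empty);
   - t feeds both s and r, which are not connected ([mrg_fork]);
   - t and s, which are not connected, both feed r ([mrg_cofork]). *)
Record merge_bicategory := MergeBicategory {
  mb_polygraph :> polygraph2;
  mrg : nat -> nat -> nat ->
    cell2 mb_polygraph -> cell2 mb_polygraph -> cell2 mb_polygraph;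
  mrg_hom : forall (t s : cell2 mb_polygraph) D1 L D2 G1 G2,
    mergeable t s D1 L D2 G1 G2 ->
    hom2 (mrg (size D1) (size G1) (size L) t s)
      (G1 ++ inp t ++ G2) (D1 ++ outp s ++ D2);
  mrg_assoc : forall (t s r : cell2 mb_polygraph) A L1 L L2 B C D E M F G H,
    let ts := mrg (size (A ++ L1)) (size C) (size L) t s in
    let sr := mrg (size E) (size (G ++ L1)) (size M) s r in
    mergeable t s (A ++ L1) L (L2 ++ B) C D ->
    mergeable ts r (A ++ E) (L1 ++ M ++ L2) (F ++ B) G H ->
    mergeable s r E M F (G ++ L1) (L2 ++ H) ->
    mergeable t sr A (L1 ++ L ++ L2) B (G ++ C) (D ++ H) ->
    mrg (size (A ++ E)) (size G) (size (L1 ++ M ++ L2)) ts r =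
    mrg (size A) (size (G ++ C)) (size (L1 ++ L ++ L2)) t sr;
  mrg_fork : forall (t s r : cell2 mb_polygraph) A L B M C D1 D2 E1 E2,
    let ts := mrg (size A) (size D1) (size L) t s in
    let tr := mrg (size (A ++ L ++ B)) (size E1) (size M) t r in
    mergeable t s A L (B ++ M ++ C) D1 D2 ->
    mergeable ts r (A ++ outp s ++ B) M C E1 E2 ->
    mergeable t r (A ++ L ++ B) M C E1 E2 ->
    mergeable tr s A L (B ++ outp r ++ C) D1 D2 ->
    mrg (size (A ++ outp s ++ B)) (size E1) (size M) ts r =
    mrg (size A) (size D1) (size L) tr s;
  mrg_cofork : forall (t s r : cell2 mb_polygraph) A L B M C D1 D2 E1 E2,
    let tr := mrg (size D1) (size A) (size L) t r in
    let sr := mrg (size E1) (size (A ++ L ++ B)) (size M) s r in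
    mergeable t r D1 L D2 A (B ++ M ++ C) ->
    mergeable s tr E1 M E2 (A ++ inp t ++ B) C ->
    mergeable s r E1 M E2 (A ++ L ++ B) C ->
    mergeable t sr D1 L D2 A (B ++ inp s ++ C) ->
    mrg (size E1) (size (A ++ inp t ++ B)) (size M) s tr =
    mrg (size D1) (size A) (size L) t sr
}.

Section MergeBicategory.
Variable X : merge_bicategory.
Implicit Types (x y z : cell0 X) (a b c e u v : cell1 X) (p q r s t : cell2 X).
Implicit Types G D : seq (cell1 X).

Definition is_unit G (i : cell2 X) : Prop :=
  [/\ hom2 i G G,
      forall t D1 D2, outp t = D1 ++ G ++ D2 ->
        mrg (size D1) 0 (size G) t i = t
    & forall s G1 G2, inp s = G1 ++ G ++ G2 ->
        mrg 0 (size G1) (size G) i s = s].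

Definition unital : Prop :=
  forall G, G <> [::] ->
    (exists x y, is_path (@src X) (@tgt X) x G y) ->
    exists i, is_unit G i.

Definition is_inverse p q : Prop :=
  [/\ hom2 q (outp p) (inp p),
      is_unit (inp p) (mrg 0 0 (size (outp p)) p q)
    & is_unit (outp p) (mrg 0 0 (size (inp p)) q p)].

(* As positions count from 0, "universal at d_j^+" is [univ_out j.-1] and
   "universal at d_i^-" is [univ_in i.-1]. *)
Definition univ_out (j : nat) t : Prop :=
  exists D1 a D2,
    [/\ outp t = D1 ++ a :: D2, size D1 = j
      & forall G1 G2 D s, D <> [::] ->
          (G1 = [::] \/ D1 = [::]) -> (G2 = [::] \/ D2 = [::]) ->
          hom2 s (G1 ++ inp t ++ G2) (D1 ++ D ++ D2) ->
          exists! r, hom2 r (G1 ++ a :: G2) D /\ mrg j (size G1) 1 t r = s].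

Definition univ_in (i : nat) t : Prop :=
  exists G1 a G2,
    [/\ inp t = G1 ++ a :: G2, size G1 = i
      & forall D1 D2 G s, G <> [::] ->
          (G1 = [::] \/ D1 = [::]) -> (G2 = [::] \/ D2 = [::]) ->
          hom2 s (G1 ++ G ++ G2) (D1 ++ outp t ++ D2) ->
          exists! r, hom2 r G (D1 ++ a :: D2) /\ mrg (size D1) i 1 r t = s].

(* The 2-cells that exhibit e as a tensor (par) unit or as tensor (par)
   universal, on the left of b or on the right of b. *)
Definition tensor_left e b c t : Prop :=
  [/\ hom2 t [:: e; b] [:: c], univ_out 0 t & univ_in 1 t].

Definition tensor_right e b c t : Prop :=
  [/\ hom2 t [:: b; e] [:: c], univ_out 0 t & univ_in 0 t].

Definition par_left e b c t : Prop :=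
  [/\ hom2 t [:: c] [:: e; b], univ_in 0 t & univ_out 1 t].

Definition par_right e b c t : Prop :=
  [/\ hom2 t [:: c] [:: b; e], univ_in 0 t & univ_out 0 t].

Definition tensor_unit x e : Prop :=
  [/\ hom1 e x x,
      forall a y, hom1 a x y -> exists t, tensor_left e a a t
    & forall b z, hom1 b z x -> exists t, tensor_right e b b t].

Definition par_unit x e : Prop :=
  [/\ hom1 e x x,
      forall a y, hom1 a x y -> exists t, par_left e a a t
    & forall b z, hom1 b z x -> exists t, par_right e b b t].

Definition tensor_universal x x' e : Prop :=
  hom1 e x x' /\
  [/\ forall a y, hom1 a x y -> exists u t, tensor_left e u a t,
      forall a' y, hom1 a' x' y -> exists v t, tensor_left e a' v t,
      forall b' z, hom1 b' z x' -> exists u' t, tensor_right e u' b' t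
    & forall b z, hom1 b z x -> exists v' t, tensor_right e b v' t].

Definition par_universal x x' e : Prop :=
  hom1 e x x' /\
  [/\ forall a y, hom1 a x y -> exists u t, par_left e u a t,
      forall a' y, hom1 a' x' y -> exists v t, par_left e a' v t,
      forall b' z, hom1 b' z x' -> exists u' t, par_right e u' b' t
    & forall b z, hom1 b z x -> exists v' t, par_right e b v' t].

Definition zero_representable : Prop :=
  unital /\
  forall x, (exists e, tensor_unit x e) /\ (exists e, par_unit x e).

End MergeBicategory.

(* Main.v *)
Require Import Defs.
From mathcomp Require Import all_boot.

(** Let t : (e, b) -> (c) exhibit tensor universality.  Universality at its only
output factors id_(e,b) as t followed by some q : (c) -> (e, b), and the
uniqueness of factorisations through t makes q a two-sided inverse
([univ_out_invertible]).  Merging with q undoes merging with t, so q is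
universal at its only input ([inverse_univ_in]).

What remains is universality of q at b: every s : (c, G) -> (e, D) must be q
merged along b with a unique r : (b, G) -> (D).  Composing with t turns s into
a 2-cell (e, b, G) -> (e, D), so the question no longer depends on t: it is
whether whiskering with e is a bijection from the 2-cells (b, G) -> (D) to the
2-cells (e, b, G) -> (e, D).  As D is non-empty, it has a first 1-cell d, which
starts where e ends, so e being tensor universal gives a 2-cell
(e, d) -> (v).  This 2-cell is invertible, so the 2-cells on the right
correspond to 2-cells (e, b, G) -> (v, D') where D = (d, D'); being universal
at d as well, it makes those correspond to 2-cells (b, G) -> (d, D')
([inverse_univ_out], stated for a context (P, Q) around b so as to cover both
e on the left of b and e on its right).

Tensor units are tensor universal 1-cells, so the same argument serves them.
The converse implications are the same statements in the merge-bicategory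
with reversed 2-cells ([co]). *)

Set Implicit Arguments.
Unset Strict Implicit.
Unset Printing Implicit Defensive.

(** * Sequences and paths *)

(** On each side of s at most one of the two contexts is non-empty, so the order
in which they are attached does not matter. *)
Lemma cat_context (T : Type) (s P Q D1 D2 : seq T) :
  P = [::] \/ D1 = [::] -> Q = [::] \/ D2 = [::] ->
  P ++ (D1 ++ s ++ D2) ++ Q = D1 ++ (P ++ s ++ Q) ++ D2.
Proof. by case=> -> [] ->; rewrite /= ?cats0 -?catA ?cats0. Qed.

Lemma cat_inj_size (T : Type) (s1 s2 t1 t2 : seq T) :
  size s1 = size t1 -> s1 ++ s2 = t1 ++ t2 -> s1 = t1 /\ s2 = t2.
Proof.
elim: s1 t1 => [|a s1 IH] [|b t1] //= [sz] [-> E].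
by have [-> ->] := IH _ sz E.
Qed.

Lemma is_path_cat (C0 C1 : Type) (src tgt : C1 -> C0) x s1 s2 z :
  is_path src tgt x (s1 ++ s2) z ->
  exists y, is_path src tgt x s1 y /\ is_path src tgt y s2 z.
Proof.
elim: s1 x => [|a s1 IH] x /=; first by exists x.
by case=> sa /IH[y [p1 p2]]; exists y.
Qed.

Section Inverses.

Variable X : merge_bicategory.
Implicit Types (a b c d e v : cell1 X) (p q r s t i : cell2 X).
Implicit Types A B C D E G P Q : seq (cell1 X).

(** * Units and inverses *)

Lemma univ_out_at t D1 a D2 G1 G2 D s :
  univ_out (size D1) t -> outp t = D1 ++ a :: D2 -> D <> [::] ->
  (G1 = [::] \/ D1 = [::]) -> (G2 = [::] \/ D2 = [::]) ->
  hom2 s (G1 ++ inp t ++ G2) (D1 ++ D ++ D2) ->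
  exists! r, hom2 r (G1 ++ a :: G2) D /\ mrg (size D1) (size G1) 1 t r = s.
Proof.
case=> [D1' [a' [D2' [ot sz U]]]]; rewrite ot.
by case/(cat_inj_size sz)=> e1 [e2 e3]; subst D1' a' D2'; apply: U.
Qed.

Lemma univ_in_at t G1 a G2 D1 D2 G s :
  univ_in (size G1) t -> inp t = G1 ++ a :: G2 -> G <> [::] ->
  (G1 = [::] \/ D1 = [::]) -> (G2 = [::] \/ D2 = [::]) ->
  hom2 s (G1 ++ G ++ G2) (D1 ++ outp t ++ D2) ->
  exists! r, hom2 r G (D1 ++ a :: D2) /\ mrg (size D1) (size G1) 1 r t = s.
Proof.
case=> [G1' [a' [G2' [it sz U]]]]; rewrite it.
by case/(cat_inj_size sz)=> e1 [e2 e3]; subst G1' a' G2'; apply: U.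
Qed.

Lemma is_inverse_sym p q : is_inverse p q -> is_inverse q p.
Proof. by case=> [[iq oq] U V]; split; rewrite /hom2 ?iq ?oq. Qed.

Lemma unital_inp (hX : unital X) p : exists i, is_unit (inp p) i.
Proof.
apply: hX; first exact: inp_neq0.
by have [x [y [P _]]] := boundary_path p; exists x, y.
Qed.

Lemma unital_outp (hX : unital X) p : exists i, is_unit (outp p) i.
Proof.
apply: hX; first exact: outp_neq0.
by have [x [y [_ P]]] := boundary_path p; exists x, y.
Qed.

Lemma mergeable_in s p D1 D2 :
  outp s = D1 ++ inp p ++ D2 -> mergeable s p D1 (inp p) D2 [::] [::].
Proof.
by move=> os; split; rewrite /= ?cats0 //; [exact: inp_neq0 | left | left].
Qed.

Lemma mergeable_out p s G1 G2 :
  inp s = G1 ++ outp p ++ G2 -> mergeable p s [::] (outp p) [::] G1 G2.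
Proof.
by move=> is_; split; rewrite /= ?cats0 //; [exact: outp_neq0 | right | right].
Qed.

Lemma mrg_assoc_in s p q D1 D2 :
  outp s = D1 ++ inp p ++ D2 -> outp p = inp q ->
  mrg (size D1) 0 (size (outp p)) (mrg (size D1) 0 (size (inp p)) s p) q =
  mrg (size D1) 0 (size (inp p)) s (mrg 0 0 (size (outp p)) p q).
Proof.
move=> os op.
have M1 := mergeable_in os.
have M2 : mergeable p q [::] (outp p) [::] [::] [::].
  by apply: mergeable_out; rewrite /= cats0.
have [i1 o1] := mrg_hom M1; have [i2 o2] := mrg_hom M2.
have := @mrg_assoc X s p q D1 [::] (inp p) [::] D2 [::] [::] [::] (outp p)
          [::] [::] [::].
rewrite /= !cats0; apply=> //.
- by rewrite op; apply: mergeable_in; rewrite o1 op.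
- by rewrite /= cats0 in i2; rewrite -i2; apply: mergeable_in; rewrite i2.
Qed.

Lemma mrg_assoc_out p q s G1 G2 :
  inp s = G1 ++ outp q ++ G2 -> outp p = inp q ->
  mrg 0 (size G1) (size (outp q)) (mrg 0 0 (size (outp p)) p q) s =
  mrg 0 (size G1) (size (outp p)) p (mrg 0 (size G1) (size (outp q)) q s).
Proof.
move=> is_ op.
have M1 := mergeable_out is_.
have M2 : mergeable p q [::] (outp p) [::] [::] [::].
  by apply: mergeable_out; rewrite /= cats0.
have [i1 o1] := mrg_hom M1; have [i2 o2] := mrg_hom M2.
have := @mrg_assoc X p q s [::] [::] (outp p) [::] [::] [::] [::] [::] (outp q)
          [::] G1 G2.
rewrite /= !cats0; apply=> //.
- by rewrite /= cats0 in o2; rewrite -o2; apply: mergeable_out; rewrite o2.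
- by apply: mergeable_out; rewrite i1 op.
Qed.

Lemma mrg_inverse_in p q s D1 D2 :
  is_inverse p q -> outp s = D1 ++ inp p ++ D2 ->
  mrg (size D1) 0 (size (outp p)) (mrg (size D1) 0 (size (inp p)) s p) q = s.
Proof.
by case=> [[iq _] [_ U _] _] os; rewrite (mrg_assoc_in os) ?iq // (U _ _ _ os).
Qed.

Lemma mrg_inverse_out p q s G1 G2 :
  is_inverse p q -> inp s = G1 ++ inp p ++ G2 ->
  mrg 0 (size G1) (size (outp p)) p (mrg 0 (size G1) (size (inp p)) q s) = s.
Proof.
case=> [[iq oq] [_ _ U] _] is_.
have := @mrg_assoc_out p q s G1 G2.
by rewrite oq => <- //; exact: U is_.
Qed.

(** Factoring the identity of the inputs of t through t yields a q such that q
after t is an identity.  Then t followed by (t after q) is again t, just as t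
followed by the identity of its output is, and the uniqueness of factorisations
through t identifies the two. *)
Lemma univ_out_invertible (hX : unital X) t c :
  outp t = [:: c] -> univ_out 0 t -> exists q, is_inverse t q.
Proof.
move=> ot U.
have [i Ui] := unital_inp hX t; have [j Uj] := unital_outp hX t.
have {}U G1 G2 D s := @univ_out_at t [::] c [::] G1 G2 D s U ot.
have [hi _ ui] := Ui; have [hj uj _] := Uj.
have [|||/= q [[[iq oq] tq] _]] := U [::] [::] (inp t) i (@inp_neq0 _ t).
- by right.
- by right.
- by rewrite /= !cats0.
have [|||/= r [_ r_uniq]] := U [::] [::] (outp t) t (@outp_neq0 _ t).
- by right.
- by right.
- by rewrite /= !cats0.
have Mqt : mergeable q t [::] (inp t) [::] [::] [::].
  by apply: mergeable_in; rewrite /= cats0.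
have [] := mrg_hom Mqt; rewrite /= !cats0 => iqt oqt.
have rj : r = j.
  apply: r_uniq; split; first by rewrite -ot.
  by have := uj t [::] [::]; rewrite ot /= => ->.
have rqt : r = mrg 0 0 (size (inp t)) q t.
  apply: r_uniq; split; first by split; rewrite ?iqt ?iq.
  have := @mrg_assoc_out t q t [::] [::].
  rewrite oq ot iq /= cats0 => <- //.
  by rewrite tq; apply: (ui t [::] [::]); rewrite /= cats0.
exists q; split; first by split; rewrite ?iq ?oq ?ot.
  by rewrite ot tq.
by rewrite -rqt rj.
Qed.

(** * Universality of inverses *)

Lemma inverse_univ_in t q c :
  is_inverse t q -> outp t = [:: c] -> univ_in 0 q.
Proof.
move=> I ot; have I' := is_inverse_sym I; have [[iq oq] _ _] := I.
rewrite ot in iq.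
exists [::], c, [::]; split=> // D1 D2 G s _ _ _.
rewrite /= cats0 oq => - [is_ os].
have [] := mrg_hom (mergeable_in os); rewrite /= cats0 => ist ost.
exists (mrg (size D1) 0 (size (inp t)) s t); split.
  split; first by split; rewrite ?ist ?ost ?is_ ?ot.
  by have := mrg_inverse_in I os; rewrite ot.
move=> r [[ir or] <-].
have := @mrg_inverse_in _ _ r D1 D2 I'.
by rewrite iq oq /= => ->.
Qed.

(** The 2-cell td is the one that universality of the context (P, Q) provides for
a 1-cell d of D; at most one of P and D1, and one of Q and D2, being non-empty,
the context can be moved next to d.  Factorisations of s through q along b then
correspond to factorisations along d, through td, of the composite of t, s
and td. *)
Lemma inverse_univ_out t q P b Q :
  is_inverse t q -> inp t = P ++ b :: Q ->
  (forall D s, D <> [::] -> outp s = P ++ D ++ Q ->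
     exists D1 d D2 td qd,
       [/\ D = D1 ++ d :: D2,
           P = [::] \/ D1 = [::],
           Q = [::] \/ D2 = [::],
           is_inverse td qd
         & inp td = P ++ d :: Q /\ univ_in (size P) td]) ->
  univ_out (size P) q.
Proof.
move=> I it H; have I' := is_inverse_sym I; have [[iq oq] _ _] := I.
exists P, b, Q; split; rewrite ?oq // => G1 G2 D s Dn0.
move=> /or_comm GP /or_comm GQ []; rewrite iq => is_ os.
have [D1 [d [D2 [td [qd [DE PD QD Id [itd Ud]]]]]]] := H D s Dn0 os.
have osE : outp s = D1 ++ inp td ++ D2.
  by rewrite os DE itd (cat_context [:: d] PD QD).
have [] := mrg_hom (mergeable_in osE).
rewrite /= cats0 is_; set s1 := mrg _ _ _ s td => i1 o1.
have [] := mrg_hom (mergeable_out i1).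
rewrite /= cats0 o1 it; set s2 := mrg _ _ _ t s1 => i2 o2.
have i2E : inp s2 = P ++ (G1 ++ b :: G2) ++ Q.
  by rewrite i2 -(cat_context [:: b] GP GQ).
have Gn0 : G1 ++ b :: G2 <> [::] by case: (G1).
have [r [[[ir or] rE] r_uniq]] := univ_in_at Ud itd Gn0 PD QD (conj i2E o2).
(* q feeds r along b, and feeds td directly along P and Q *)
have assoc r' : inp r' = G1 ++ b :: G2 -> outp r' = D ->
    hom2 (mrg (size P) (size G1) 1 q r') (inp s) (outp s) /\
    mrg (size D1) 0 (size (inp td)) (mrg (size P) (size G1) 1 q r') td =
    mrg 0 (size G1) (size (inp t)) q (mrg (size D1) (size P) 1 r' td).
  move=> ir' or'.
  have M1 : mergeable q r' P [:: b] Q G1 G2.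
    by split; rewrite ?oq ?it //; apply/or_comm.
  have M2 : mergeable r' td D1 [:: d] D2 P Q by split; rewrite ?or' ?DE.
  have [i3 o3] := mrg_hom M1; have [i4 o4] := mrg_hom M2.
  rewrite or' in o3; rewrite ir' in i4.
  split; first by split; rewrite ?i3 ?o3 ?is_ ?os ?iq.
  have := @mrg_assoc X q r' td [::] P [:: b] Q [::] G1 G2 D1 [:: d] D2 [::] [::].
  rewrite /= !cats0 itd it; apply=> //.
  - by rewrite -[_ ++ _ :: _]itd; apply: mergeable_in; rewrite o3 -os osE.
  - split; rewrite /= ?cats0 ?oq //; [|by case: (P) | by right | by right].
    by rewrite i4 (cat_context [:: b] GP GQ).
exists r; split.
  (* merging with td is injective, having an inverse *)
  rewrite -DE in or; have [[ia oa] aE] := assoc r ir or; split=> //.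
  rewrite -(mrg_inverse_in Id osE) -/s1.
  rewrite -[LHS](mrg_inverse_in Id (etrans oa osE)) aE rE.
  have := @mrg_inverse_out q t s1 G1 G2 I'.
  by rewrite oq iq => ->.
move=> r' [[ir' or'] qr']; apply: r_uniq; split; first by rewrite -DE.
have [_] := assoc r' ir' or'; rewrite qr' -/s1 => s1E.
rewrite /s2 s1E (mrg_inverse_out (G2 := G2) I) //.
have M2 : mergeable r' td D1 [:: d] D2 P Q by split; rewrite ?or' ?DE.
have [-> _] := mrg_hom M2.
by rewrite ir' it -i2E i2 -!catA.
Qed.

(** * Tensor universality gives par universality *)

Lemma tensor_left_inverse (hX : unital X) e b c t :
  (forall a, src a = tgt e -> exists v t', tensor_left e a v t') ->
  tensor_left e b c t -> exists q, is_inverse t q /\ par_left e b c q.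
Proof.
move=> He [[it ot] Uo _].
have [q I] := univ_out_invertible hX ot Uo; exists q; split=> //.
have [[iq oq] _ _] := I.
split; first by split; rewrite ?iq ?oq.
  exact: inverse_univ_in I ot.
apply: (@inverse_univ_out t q [:: e] b [::]) => // -[//|d D] s _ /=.
rewrite cats0 => os.
have [x [y [_]]] := boundary_path s; rewrite os /= => - [_ [sd _]].
have [v [td [[itd otd] Udo Udi]]] := He d sd.
have [qd Id] := univ_out_invertible hX otd Udo.
by exists [::], d, D, td, qd; split; auto.
Qed.

Lemma tensor_right_inverse (hX : unital X) e b c t :
  (forall a, tgt a = src e -> exists v t', tensor_right e a v t') ->
  tensor_right e b c t -> exists q, is_inverse t q /\ par_right e b c q.
Proof.
move=> He [[it ot] Uo _].
have [q I] := univ_out_invertible hX ot Uo; exists q; split=> //.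
have [[iq oq] _ _] := I.
split; first by split; rewrite ?iq ?oq.
  exact: inverse_univ_in I ot.
apply: (@inverse_univ_out t q [::] b [:: e]) => // D s.
case/lastP: D => [//|D d] _ /=; rewrite cat_rcons => os.
have [x [y [_ path_s]]] := boundary_path s; rewrite os in path_s.
have [w [_ /= [_ [se _]]]] := is_path_cat path_s.
have [v [td [[itd otd] Udo Udi]]] := He d (esym se).
have [qd Id] := univ_out_invertible hX otd Udo.
by exists D, d, [::], td, qd; split; rewrite ?cats1; auto.
Qed.

Lemma tensor_unit_universal x e : tensor_unit x e -> tensor_universal x x e.
Proof.
case=> he Hl Hr; split=> //; split.
- by move=> a y /Hl; exists a.
- by move=> a y /Hl; exists a.
- by move=> b z /Hr; exists b.
- by move=> b z /Hr; exists b.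
Qed.

Lemma tensor_universal_inverse (hX : unital X) x x' e :
  tensor_universal x x' e ->
  (forall b c t, tensor_left e b c t ->
     exists q, is_inverse t q /\ par_left e b c q) /\
  (forall b c t, tensor_right e b c t ->
     exists q, is_inverse t q /\ par_right e b c q).
Proof.
case=> [[se te] [_ Hl _ Hr]]; split=> b c t.
  by apply: tensor_left_inverse => // a sa; apply: Hl; split; rewrite ?sa.
by apply: tensor_right_inverse => // a ta; apply: Hr; split; rewrite ?ta.
Qed.

Lemma tensor_unit_par (hX : unital X) x e : tensor_unit x e -> par_unit x e.
Proof.
move=> U; have [Il Ir] := tensor_universal_inverse hX (tensor_unit_universal U).
have [he Hl Hr] := U; split=> //.
  by move=> a y /Hl[t /Il[q [_ ?]]]; exists q.
by move=> b z /Hr[t /Ir[q [_ ?]]]; exists q.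
Qed.

Lemma tensor_universal_par (hX : unital X) x x' e :
  tensor_universal x x' e -> par_universal x x' e.
Proof.
move=> U; have [Il Ir] := tensor_universal_inverse hX U.
have [he [H1 H2 H3 H4]] := U; split=> //; split.
- by move=> a y /H1[u [t /Il[q [_ ?]]]]; exists u, q.
- by move=> a y /H2[u [t /Il[q [_ ?]]]]; exists u, q.
- by move=> a y /H3[u [t /Ir[q [_ ?]]]]; exists u, q.
- by move=> a y /H4[u [t /Ir[q [_ ?]]]]; exists u, q.
Qed.

End Inverses.

(** * Reversing the 2-cells *)

Definition co_polygraph (X : polygraph2) : polygraph2.
Proof.
apply: (@Polygraph2 (cell0 X) (cell1 X) (cell2 X) (@src X) (@tgt X)
          (@outp X) (@inp X)).
- exact: outp_neq0.
- exact: inp_neq0.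
- by move=> p; have [x [y [? ?]]] := boundary_path p; exists x, y.
Defined.

Lemma mergeable_co (X : polygraph2) (t s : cell2 X) D1 L D2 G1 G2 :
  @mergeable (co_polygraph X) t s D1 L D2 G1 G2 -> mergeable s t G1 L G2 D1 D2.
Proof. by case=> ? ? ? ? ?; split=> //; apply/or_comm. Qed.

(** Reversal exchanges the law for a 2-cell feeding two others with the law for
two 2-cells feeding a third, and preserves the law for a chain of three. *)
Definition co (X : merge_bicategory) : merge_bicategory.
Proof.
apply: (@MergeBicategory (co_polygraph X) (fun j i l t s => @mrg X i j l s t)).
- by move=> t s D1 L D2 G1 G2 /mergeable_co/mrg_hom[].
- move=> t s r A L1 L L2 B C D E M F G H.
  move=> /= /mergeable_co m1 /mergeable_co m2 /mergeable_co m3 /mergeable_co m4.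
  by apply/esym/mrg_assoc; [exact: m3 | exact: m4 | exact: m1 | exact: m2].
- move=> t s r A L B M C D1 D2 E1 E2.
  move=> /= /mergeable_co m1 /mergeable_co m2 /mergeable_co m3 /mergeable_co m4.
  by apply: mrg_cofork; [exact: m1 | exact: m2 | exact: m3 | exact: m4].
- move=> t s r A L B M C D1 D2 E1 E2.
  move=> /= /mergeable_co m1 /mergeable_co m2 /mergeable_co m3 /mergeable_co m4.
  by apply: mrg_fork; [exact: m1 | exact: m2 | exact: m3 | exact: m4].
Defined.

Section Co.

Variable X : merge_bicategory.
Implicit Types (b c e : cell1 X) (t : cell2 X).

Lemma unital_co : unital X -> unital (co X).
Proof.
move=> hX G G0 /(hX G G0)[i [[ii oi] U V]].
by exists i; split.
Qed.

Lemma univ_in_co j t : univ_in j t <-> @univ_out (co X) j t.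
Proof.
split=> - [P [a [Q [it sz U]]]]; exists P, a, Q; split=> //.
  move=> D1 D2 G s G0 /or_comm h1 /or_comm h2 [os is_].
  have [r [[[ir or] rE] r_uniq]] := U D1 D2 G s G0 h1 h2 (conj is_ os).
  by exists r; split=> // r' [[? ?] ?]; apply: r_uniq.
move=> D1 D2 G s G0 /or_comm h1 /or_comm h2 [os is_].
have [r [[[ir or] rE] r_uniq]] := U D1 D2 G s G0 h1 h2 (conj is_ os).
by exists r; split=> // r' [[? ?] ?]; apply: r_uniq.
Qed.

Lemma univ_out_co j t : univ_out j t <-> @univ_in (co X) j t.
Proof.
split=> - [P [a [Q [it sz U]]]]; exists P, a, Q; split=> //.
  move=> D1 D2 G s G0 /or_comm h1 /or_comm h2 [os is_].
  have [r [[[ir or] rE] r_uniq]] := U D1 D2 G s G0 h1 h2 (conj is_ os).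
  by exists r; split=> // r' [[? ?] ?]; apply: r_uniq.
move=> D1 D2 G s G0 /or_comm h1 /or_comm h2 [os is_].
have [r [[[ir or] rE] r_uniq]] := U D1 D2 G s G0 h1 h2 (conj is_ os).
by exists r; split=> // r' [[? ?] ?]; apply: r_uniq.
Qed.

Lemma par_left_co e b c t : par_left e b c t -> @tensor_left (co X) e b c t.
Proof.
by case=> [[? ?] /univ_in_co ? /univ_out_co ?].
Qed.

Lemma par_right_co e b c t : par_right e b c t -> @tensor_right (co X) e b c t.
Proof.
by case=> [[? ?] /univ_in_co ? /univ_out_co ?].
Qed.

Lemma tensor_left_co e b c t : @par_left (co X) e b c t -> tensor_left e b c t.
Proof.
by case=> [[? ?] /univ_out_co ? /univ_in_co ?].
Qed.

Lemma tensor_right_co e b c t :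
  @par_right (co X) e b c t -> tensor_right e b c t.
Proof.
by case=> [[? ?] /univ_out_co ? /univ_in_co ?].
Qed.

Lemma par_unit_tensor (hX : unital X) x e : par_unit x e -> tensor_unit x e.
Proof.
case=> he Hl Hr.
have [|_ Kl Kr] := @tensor_unit_par _ (unital_co hX) x e.
  split=> //.
    by move=> a y /Hl[t /par_left_co ?]; exists t.
  by move=> b z /Hr[t /par_right_co ?]; exists t.
split=> //.
  by move=> a y /Kl[t /tensor_left_co ?]; exists t.
by move=> b z /Kr[t /tensor_right_co ?]; exists t.
Qed.

Lemma par_universal_tensor (hX : unital X) x x' e :
  par_universal x x' e -> tensor_universal x x' e.
Proof.
case=> he [H1 H2 H3 H4].
have [|_ [K1 K2 K3 K4]] := @tensor_universal_par _ (unital_co hX) x x' e.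
  split=> //; split.
  - by move=> a y /H1[u [t /par_left_co ?]]; exists u, t.
  - by move=> a y /H2[u [t /par_left_co ?]]; exists u, t.
  - by move=> b z /H3[u [t /par_right_co ?]]; exists u, t.
  - by move=> b z /H4[u [t /par_right_co ?]]; exists u, t.
split=> //; split.
- by move=> a y /K1[u [t /tensor_left_co ?]]; exists u, t.
- by move=> a y /K2[u [t /tensor_left_co ?]]; exists u, t.
- by move=> b z /K3[u [t /tensor_right_co ?]]; exists u, t.
- by move=> b z /K4[u [t /tensor_right_co ?]]; exists u, t.
Qed.

End Co.

Unset Implicit Arguments.

(** * Tensor and par universality coincide *)

Theorem proposition5p12 (X : merge_bicategory) (hX : zero_representable X) :
  (forall (x : cell0 X) (e : cell1 X), hom1 e x x ->
     (tensor_unit x e <-> par_unit x e)) /\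
  (forall (x y : cell0 X) (e : cell1 X), hom1 e x y ->
     (tensor_universal x y e <-> par_universal x y e)) /\
  (forall (x : cell0 X) (e : cell1 X), tensor_unit x e ->
     (forall (a : cell1 X) (t : cell2 X), tensor_left e a a t ->
        exists q : cell2 X, is_inverse t q /\ par_left e a a q) /\
     (forall (b : cell1 X) (t : cell2 X), tensor_right e b b t ->
        exists q : cell2 X, is_inverse t q /\ par_right e b b q)) /\
  (forall (x y : cell0 X) (e : cell1 X), tensor_universal x y e ->
     (forall (b c : cell1 X) (t : cell2 X), tensor_left e b c t ->
        exists q : cell2 X, is_inverse t q /\ par_left e b c q) /\
     (forall (b c : cell1 X) (t : cell2 X), tensor_right e b c t ->
        exists q : cell2 X, is_inverse t q /\ par_right e b c q)).
Proof.
case: hX => hX _; split; last split; last split.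
- by move=> x e _; split; [exact: tensor_unit_par | exact: par_unit_tensor].
- move=> x y e _.
  by split; [exact: tensor_universal_par | exact: par_universal_tensor].
- move=> x e /tensor_unit_universal/(tensor_universal_inverse hX)[Il Ir].
  by split=> [a t /Il | b t /Ir].
- by move=> x y e; exact: tensor_universal_inverse.
Qed.
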